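(* Let $n\ge 2$. Let $\mathcal{G}_n$ be the labeled directed graph with vertex set $V=\{v_0,\dots,v_{n-1}\}$, with labels in $\{0,1,\dots,2n-1\}$, and with the following edges: for each $i$, the vertex $v_i$ has $n-1$ self-loops, labeled by the symbols of $\{n,n+1,\dots,2n-1\}\setminus\{n+i\}$, one loop for each symbol; and for each ordered pair of distinct vertices $v_i,v_j$ there is one edge from $v_i$ to $v_j$, labeled by the least nonnegative residue of $j-i$ modulo $n$. Let $Y_n$ be the one-sided sofic shift presented by $\mathcal{G}_n$. Let $\mathcal{H}_n$ be the labeled graph obtained from $\mathcal{G}_n$ by the subset construction. Then $(\mathcal{H}_n,V)$ is a minimal right-resolving presentation of $Y_n$ as a path set: $X_{\mathcal{H}_n}(V)=Y_n$, the graph $\mathcal{H}_n$ is right-resolving with $2^n-1$ vertices, and every pointed graph $(\mathcal{H}',v')$ with $\mathcal{H}'$ right-resolving and $X_{\mathcal{H}'}(v')=Y_n$ has at least $2^n-1$ vertices.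
   Context: A labeled directed graph over a finite alphabet $\mathcal{A}$ is a finite directed graph whose edges carry labels from $\mathcal{A}$, the triples (initial vertex, terminal vertex, label) being distinct; a pointed graph $(\mathcal{G},v)$ is such a graph with a distinguished vertex $v$, and $X_{\mathcal{G}}(v)\subseteq\mathcal{A}^{\mathbb{N}}$ is the set of all sequences of successive edge labels of one-sided infinite walks in $\mathcal{G}$ starting at $v$; $(\mathcal{G},v)$ is a presentation of this set as a path set. The one-sided sofic shift presented by $\mathcal{G}$ is the set of all label sequences of one-sided infinite walks in $\mathcal{G}$ starting from any vertex. A labeled graph is right-resolving if at each vertex there is at most one exit edge with any given label. The subset construction applied to $\mathcal{G}$ yields the labeled graph $\mathcal{H}$ whose vertices are the nonempty subsets $S$ of $V(\mathcal{G})$, where for each label $a$ there is exactly one edge labeled $a$ from $S$ to $S'=\{w\in V(\mathcal{G}):\text{there is an edge labeled } a \text{ from some } u\in S \text{ to } w\}$ if $S'\neq\emptyset$, and no edge labeled $a$ leaving $S$ if $S'=\emptyset$. Here the full set $V$ is viewed as a vertex of $\mathcal{H}_n$. *)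

(* Defs.v *)
From mathcomp Require Import all_boot all_order all_algebra.

Set Implicit Arguments.
Unset Strict Implicit.
Unset Printing Implicit Defensive.

(* [edge u a v] is the membership test of the set of edges, as triples
   (initial vertex, label, terminal vertex); distinctness of the triples is
   thus built in. *)
Record labeledGraph (A : finType) := LabeledGraph {
  vertex : finType;
  edge : vertex -> A -> vertex -> bool
}.

Definition pathSet (A : finType) (G : labeledGraph A) (v : vertex G)
    (x : nat -> A) : Prop :=
  exists w : nat -> vertex G,
    w 0 = v /\ forall k, edge (w k) (x k) (w k.+1).

Definition soficShift (A : finType) (G : labeledGraph A) (x : nat -> A) : Prop :=
  exists v : vertex G, pathSet v x.

Definition presents (A : finType) (G : labeledGraph A) (v : vertex G)
    (X : (nat -> A) -> Prop) : Prop :=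
  forall x : nat -> A, pathSet v x <-> X x.

Definition rightResolving (A : finType) (G : labeledGraph A) : Prop :=
  forall (u : vertex G) (a : A) (v1 v2 : vertex G),
    edge u a v1 -> edge u a v2 -> v1 = v2.

Definition successors (A : finType) (G : labeledGraph A)
    (S : {set vertex G}) (a : A) : {set vertex G} :=
  [set w | [exists u in S, edge u a w]].

(* When [successors S a] is empty, it is the value of no vertex, so that no edge
   labeled [a] leaves [S]. *)
Definition subsetGraph (A : finType) (G : labeledGraph A) : labeledGraph A :=
  @LabeledGraph A {S : {set vertex G} | S != set0}
    (fun S a S' => val S' == successors (val S) a).

(* The residue [_ %% n] is computed in [int], where it is nonnegative. *)
Definition graphG (n : nat) : labeledGraph 'I_(2 * n) :=
  @LabeledGraph 'I_(2 * n) 'I_n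
    (fun i a j =>
       if i == j then (n <= a) && (a != n + i :> nat)
       else (a%:Z == ((j%:Z - i%:Z) %% n%:Z)%Z)%R).

Definition graphH (n : nat) : labeledGraph 'I_(2 * n) := subsetGraph (graphG n).

Lemma fullSet_neq0 (n : nat) : 1 < n -> [set: vertex (graphG n)] != set0.
Proof. by move=> hn; apply/set0Pn; exists (Ordinal (ltnW hn)); rewrite inE. Qed.

Definition fullVertex (n : nat) (hn : 1 < n) : vertex (graphH n) :=
  exist _ [set: vertex (graphG n)] (fullSet_neq0 hn).

(* Main.v *)
Require Import Defs.
From mathcomp Require Import all_boot all_order all_algebra.
From mathcomp Require Import zify boolp.

Set Implicit Arguments.
Unset Strict Implicit.
Unset Printing Implicit Defensive.

(* Konig's lemma shows that the subset construction, started at the set of all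
   vertices, presents the sofic shift.  For minimality only the loop labels
   n + j matter: reading n + j leaves every vertex in place but kills the walks
   at v_j.  Hence the word of all n + j with j outside S leads from V to S, and
   the vertices of a right-resolving presentation reached by these words are
   pairwise distinct: if i is in S but not in T, reading all n + j with j in T
   kills T but not the vertex v_i of S. *)

(** * Runs of the subset construction and Konig's lemma *)

Section LabeledGraphs.

Variables (A : finType) (G : labeledGraph A).

(** The run of the subset construction on [x], made total by keeping the empty set as an absorbing
    state. *)
Fixpoint stepSet (S : {set vertex G}) (x : nat -> A) (k : nat) :=
  if k is k'.+1 then successors (stepSet S x k') (x k') else S.

Lemma in_successors (S : {set vertex G}) a w :
  reflect (exists2 u, u \in S & edge u a w) (w \in successors S a).
Proof. by rewrite inE; apply: exists_inP. Qed.

Lemma successors0 a : successors (set0 : {set vertex G}) a = set0.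
Proof.
by apply/setP => w; rewrite in_set0; apply/in_successors => -[u]; rewrite inE.
Qed.

Lemma stepSet_eq0 S x m k :
  m <= k -> stepSet S x m = set0 -> stepSet S x k = set0.
Proof.
move=> /subnKC <- S0; elim: (k - m) => [|j IH]; first by rewrite addn0.
by rewrite addnS /= IH successors0.
Qed.

Lemma stepSetS S x k :
  stepSet S x k.+1 = stepSet (successors S (x 0)) (fun j => x j.+1) k.
Proof. by elim: k => //= k <-. Qed.

Lemma stepSet_set1 S x k w :
  w \in stepSet S x k -> exists2 v, v \in S & w \in stepSet [set v] x k.
Proof.
elim: k w => [|k IH] w /=; first by exists w; rewrite ?set11.
case/in_successors => u /IH [v vS uv] uw; exists v => //.
by apply/in_successors; exists u.
Qed.

Definition live (S : {set vertex G}) (x : nat -> A) :=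
  forall k, stepSet S x k != set0.

(** If every [v] in [S] died at some time [m v], then all of them would be dead at the maximum of
    these finitely many times, and so would [S]. *)
Lemma live_set1 S x : live S x -> exists2 v, v \in S & live [set v] x.
Proof.
move=> liveS; apply: contrapT => /forall2NP dead.
have /fin_all_exists[m m0] (v : vertex G) :
    exists m, v \in S -> stepSet [set v] x m = set0.
  (* For [v] outside [S] the time 0 is a dummy value. *)
  have [vS|/existsNP[m /negP]] := dead v; first by exists 0.
  by rewrite negbK => /eqP; exists m.
have /set0Pn[w /stepSet_set1[v vS]] := liveS (\max_v m v).
by rewrite (stepSet_eq0 (leq_bigmax v) (m0 v vS)) inE.
Qed.

(* Konig's lemma: finiteness of [G] is used through [live_set1]. *)
Lemma live_pathSet S x : live S x -> exists v : vertex G, pathSet v x.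
Proof.
move=> /live_set1[v0 _ live0].
(* A vertex live at time [p.1] has a successor live at the next time; [next] chooses one, and its
   value at other vertices is irrelevant. *)
have /choice[next nextP] (p : nat * vertex G) : exists w : vertex G,
    live [set p.2] (fun j => x (p.1 + j)) ->
    edge p.2 (x p.1) w /\ live [set w] (fun j => x (p.1.+1 + j)).
  case: p => k v /=.
  have [liv|] := pselect (live [set v] (fun j => x (k + j))); last by exists v.
  have /live_set1[w /in_successors[u /set1P-> vw] livew] :
      live (successors [set v] (x k)) (fun j => x (k.+1 + j)).
    move=> m; have := liv m.+1; rewrite stepSetS addn0.
    by under [fun j => x (k + j.+1)]funext => j do rewrite -addSnnS.
  by exists w.
pose w := fix w k := if k is k'.+1 then next (k', w k') else v0.
have livew k : live [set w k] (fun j => x (k + j)).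
  by elim: k => [|k /(nextP (k, _))[]].
exists v0, w; split=> // k.
by case: (nextP (k, w k) (livew k)).
Qed.

(** The only possible walk from [V] labeled [x] is the sequence of the [stepSet setT x k], and it
    exists exactly when none of these sets is empty. *)
Lemma subsetGraph_presents (V : vertex (subsetGraph G)) :
  val V = setT -> presents V (soficShift G).
Proof.
move=> VT x; split.
  case=> W [W0 WE]; apply: (@live_pathSet setT) => k.
  suff <- : val (W k) = stepSet setT x k by exact: valP (W k).
  by elim: k => [|k IH]; [rewrite W0 | rewrite /= -IH; apply/eqP/WE].
case=> v [w [_ wE]].
have wS k : w k \in stepSet setT x k.
  by elim: k => [|k IH]; [rewrite inE | apply/in_successors; exists (w k)].
have S0 k : stepSet setT x k != set0 by apply/set0Pn; exists (w k).
exists (fun k => exist _ (stepSet setT x k) (S0 k)); split=> [|k /=].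
  by apply: val_inj.
exact: eqxx.
Qed.

Lemma subsetGraph_rightResolving : rightResolving (subsetGraph G).
Proof. by move=> S a S1 S2 /eqP e1 /eqP e2; apply: val_inj; rewrite e1. Qed.

Lemma card_subsetGraph : #|vertex (subsetGraph G)| = 2 ^ #|vertex G| - 1.
Proof.
rewrite /= card_sig -cardsT -card_powerset (cardsD1 set0) inE sub0set addKn.
by rewrite -cardsE; apply: eq_card => S; rewrite !inE subsetT andbT.
Qed.

End LabeledGraphs.

Fixpoint prepend (A : Type) (s : seq A) (x : nat -> A) : nat -> A :=
  if s is a :: s' then fun k => if k is k'.+1 then prepend s' x k' else a else x.

Lemma prepend_map A B (f : A -> B) s x :
  prepend (map f s) (f \o x) = f \o prepend s x.
Proof. by elim: s => //= a s ->; apply/funext; case. Qed.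

Lemma prepend_neq (A : eqType) (s : seq A) x a :
  (forall k, prepend s x k != a) <-> a \notin s /\ forall k, x k != a.
Proof.
elim: s => [|b s [IH1 IH2]] /=; first by split=> [|[]].
rewrite inE negb_or eq_sym; split=> [ne|[/andP[ba as_] xa] [|k] //].
  have /IH1[-> ?] : forall k, prepend s x k != a by move=> k; apply: (ne k.+1).
  by rewrite (ne 0).
exact: IH2.
Qed.

(** * Lower bound for right-resolving presentations by counting follower sets *)

Section MyhillNerode.

Variables (A : finType) (G : labeledGraph A).

Fixpoint reads (u : vertex G) (s : seq A) (v : vertex G) : Prop :=
  if s is a :: s' then exists2 w, edge u a w & reads w s' v else u = v.

Lemma reads_inj u s v1 v2 :
  rightResolving G -> reads u s v1 -> reads u s v2 -> v1 = v2.
Proof.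
move=> rrG; elim: s u => [|a s IH] u /=; first by move=> <-.
by case=> w1 uw1 r1 [w2 uw2 r2]; apply: IH r1 _; rewrite (rrG _ _ _ _ uw1 uw2).
Qed.

Lemma pathSet_prepend (u : vertex G) s x :
  pathSet u (prepend s x) <-> exists2 v, reads u s v & pathSet v x.
Proof.
elim: s u => [|a s IH] u /=; first by split=> [|[v ->]] //; exists u.
split=> [[w [<- wE]]|[v [w uw wv] vx]].
  have /IH[v r vx] : pathSet (w 1) (prepend s x).
    by exists (fun k => w k.+1); split=> // k; apply: (wE k.+1).
  by exists v => //; exists (w 1) => //; apply: (wE 0).
have /IH[p [p0 pE]] : exists2 v, reads w s v & pathSet v x by exists v.
exists (fun k => if k is k'.+1 then p k' else u); split=> // -[|k] //.
by rewrite p0.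
Qed.

(** By right-resolution [word i] leads from [v] to a single vertex, whose path set is the follower
    set of [word i] in [X]. Distinct follower sets thus require distinct vertices. *)
Lemma leq_card_rightResolving (I : finType) (word : I -> seq A)
    (X : (nat -> A) -> Prop) (v : vertex G) :
  rightResolving G -> presents v X ->
  (forall i, exists x, X (prepend (word i) x)) ->
  (forall i j, (forall x, X (prepend (word i) x) <-> X (prepend (word j) x)) ->
     i = j) ->
  #|I| <= #|vertex G|.
Proof.
move=> rrG vX ext sep.
have /fin_all_exists[f fP] i : exists u, reads v (word i) u.
  by have [x /vX/pathSet_prepend[u]] := ext i; exists u.
have XE i x : X (prepend (word i) x) <-> pathSet (f i) x.
  split=> [/vX/pathSet_prepend[u r]|fx].
    by rewrite (reads_inj rrG (fP i) r).
  by apply/vX/pathSet_prepend; exists (f i).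
by apply: (leq_card f) => i j fij; apply: sep => x; rewrite !XE fij.
Qed.

End MyhillNerode.

(** * Loop labels and the words that separate subsets *)

Section GraphG.

Variable n : nat.

Lemma loopLabel_subproof (j : 'I_n) : n + j < 2 * n.
Proof. by rewrite mul2n -addnn ltn_add2l. Qed.

Definition loopLabel (j : 'I_n) : 'I_(2 * n) := Ordinal (loopLabel_subproof j).

Lemma edge_loopLabel (i k j : 'I_n) :
  @edge _ (graphG n) i (loopLabel j) k = (i == k) && (j != i).
Proof.
rewrite /=; case: eqP => _; first by rewrite leq_addr eqn_add2l.
(* Edges between distinct vertices carry labels below [n], whereas loop labels are at least [n]. *)
have ltn : ((k%:Z - i%:Z) %% n%:Z < n%:Z)%Z%R.
  by apply: ltz_pmod; have := ltn_ord i; lia.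
apply/negP => /eqP e; move: ltn; rewrite -e; lia.
Qed.

Lemma soficShift_loopLabel (y : nat -> 'I_n) :
  soficShift (graphG n) (loopLabel \o y) <-> exists i, forall k, y k != i.
Proof.
split=> [[v [w [w0 wE]]]|[i yi]].
  have wv k : w k = v.
    elim: k => // k <-; have := wE k.
    by rewrite edge_loopLabel => /andP[/eqP].
  by exists v => k; have := wE k; rewrite edge_loopLabel wv => /andP[].
exists i, (fun=> i); split=> // k.
by rewrite edge_loopLabel eqxx yi.
Qed.

Definition loopWord (S : {set 'I_n}) : seq 'I_(2 * n) :=
  map loopLabel (enum (~: S)).

Lemma soficShift_loopWord (S : {set 'I_n}) y :
  soficShift (graphG n) (prepend (loopWord S) (loopLabel \o y)) <->
  exists2 i, i \in S & forall k, y k != i.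
Proof.
rewrite prepend_map soficShift_loopLabel.
split=> [[i /prepend_neq[]]|[i iS yi]].
  by rewrite mem_enum inE negbK; exists i.
by exists i; apply/prepend_neq; rewrite mem_enum inE negbK.
Qed.

Hypothesis n_gt1 : 1 < n.

Lemma exists_neq (i : 'I_n) : exists c : 'I_n, c != i.
Proof.
have /card_gt1P[a [b [_ _ ab]]] : 1 < #|'I_n| by rewrite card_ord.
by have [ai|] := eqVneq a i; [exists b; rewrite -ai eq_sym | exists a].
Qed.

Lemma loopWord_separates (S T : {set 'I_n}) :
  (forall x, soficShift (graphG n) (prepend (loopWord S) x) ->
             soficShift (graphG n) (prepend (loopWord T) x)) ->
  S \subset T.
Proof.
move=> imp; apply/subsetP => i iS; apply: contraT => iT.
(* The constant tail [c] makes the test word [enum T] infinite; it differs from [i] so that the walk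
   at [i] survives. *)
have [c ci] := exists_neq i.
have /soficShift_loopWord[j jT /prepend_neq[]] :
    soficShift (graphG n) (prepend (loopWord T)
      (loopLabel \o prepend (enum T) (fun=> c))).
  apply/imp/soficShift_loopWord; exists i => //.
  by apply/prepend_neq; rewrite mem_enum.
by rewrite mem_enum jT.
Qed.

End GraphG.

Theorem mainTheorem9 (n : nat) (hn : 1 < n) :
  [/\ presents (fullVertex hn) (soficShift (graphG n)),
      rightResolving (graphH n),
      #|vertex (graphH n)| = 2 ^ n - 1
    & forall (H' : labeledGraph 'I_(2 * n)) (v' : vertex H'),
        rightResolving H' ->
        presents v' (soficShift (graphG n)) ->
        2 ^ n - 1 <= #|vertex H'| ].
Proof.
have cardH : #|vertex (graphH n)| = 2 ^ n - 1.
  by rewrite card_subsetGraph /= card_ord.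
split=> // [||H' v' rrH' v'Y].
- exact: subsetGraph_presents.
- exact: subsetGraph_rightResolving.
rewrite -cardH.
apply: (leq_card_rightResolving (word := fun S : vertex (graphH n) =>
  loopWord (val S)) rrH' v'Y) => [S|S T eqY].
  (* Since [S] is nonempty, some vertex survives its word, and the word extends to a point of the
     shift. *)
  have /set0Pn[i iS] := valP S; have [c ci] := exists_neq hn i.
  by exists (@loopLabel n \o fun=> c); apply/soficShift_loopWord; exists i.
apply/val_inj/eqP; rewrite eqEsubset.
by rewrite !(@loopWord_separates n hn) // => x /eqY.
Qed.
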